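(* Suppose that $G$ is a locally compact non-discrete group. Then $G^*=G^{luc}\setminus G$ does not contain any $P$-point.
   Context: Locally compact groups are Hausdorff and functions are complex-valued. $C_b(G)$ is the Banach space of bounded continuous functions on $G$ with the uniform norm; for $g\in G$, $l_gf(x)=f(gx)$. $LUC(G)$ is the $C^*$-algebra of all $f\in C_b(G)$ such that $g\mapsto l_gf$ is continuous from $G$ to $C_b(G)$. $G^{luc}$ is the Gelfand spectrum of $LUC(G)$ (nonzero multiplicative linear functionals in $LUC(G)^*$) with the weak-star topology; $G$ is identified with its image in $G^{luc}$ under point evaluations, and $G^*=G^{luc}\setminus G$ carries the subspace topology. A point of a topological space is a $P$-point if every $G_\delta$-set containing the point is a neighbourhood of the point. *)

(* Defs.v *)
From HB Require Import structures.
From mathcomp Require Import all_boot all_order all_algebra complex.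
From mathcomp Require Import all_classical all_reals topology normedtype.
From mathcomp Require Import subtype_topology borel_hierarchy.

Set Implicit Arguments.
Unset Strict Implicit.
Unset Printing Implicit Defensive.

Import Order.TTheory GRing.Theory Num.Theory.
Import numFieldNormedType.Exports.

Local Open Scope classical_set_scope.
Local Open Scope ring_scope.

HB.mixin Record Group_isTopologicalGroup G of Group G & Topological G := {
  mulg_continuous : continuous (fun xy : G * G => (xy.1 * xy.2)%g);
  invg_continuous : continuous (fun x : G => (x^-1)%g)
}.

#[short(type="topologicalGroupType")]
HB.structure Definition TopologicalGroup :=
  {G of Group G & Topological G & Group_isTopologicalGroup G}.

(* Typing the complex numbers as a [numClosedFieldType] gives them the
   topology and the norm that the library attaches to every such field. *)
Definition Cplx (R : realType) : numClosedFieldType := R[i].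

Section LUC.
Variables (R : realType) (G : topologicalGroupType).
Local Notation C := (Cplx R).

Definition ltranslate (g : G) (f : G -> C) : G -> C := fun x => f (g * x)%g.

Definition Cb : set (G -> C) := [set f | continuous f /\ bounded_fun f].

(* On [Cb] the topology of [{uniform G -> C}] is that of the uniform norm. *)
Definition is_LUC : set (G -> C) :=
  [set f | Cb f /\ continuous (fun g => ltranslate g f : {uniform G -> C})].

Lemma cvg_uniformP (F : set_system (G -> C)) (f : G -> C) : Filter F ->
  F --> (f : {uniform G -> C}) <->
  forall e : C, 0 < e -> \forall h \near F, forall x, `|f x - h x| < e.
Proof.
move=> FF; split.
  move=> Ff e e0; apply: (Ff [set h | forall x, `|f x - h x| < e]).
  apply/uniform_nbhs; exists [set xy | ball xy.1 e xy.2]; split => /=.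
    by rewrite -entourage_ballE; exists e.
  by move=> h /= fh x; exact: fh.
move=> Ff A /uniform_nbhs[E [+ EA]].
rewrite -entourage_ballE => -[e/= e0 eE]; apply: filterS (Ff _ e0) => h fh.
by apply: EA => x _; apply: eE; exact: fh.
Qed.

Lemma ltranslate_continuousP (f : G -> C) :
  continuous (fun g => ltranslate g f : {uniform G -> C}) <->
  forall g (e : C), 0 < e ->
    \forall h \near g, forall x, `|f (g * x)%g - f (h * x)%g| < e.
Proof.
split=> cf g.
  by have /cvg_uniformP := cf g; exact.
by apply/cvg_uniformP => e e0; exact: cf.
Qed.

Lemma bounded_funE (f : G -> C) :
  bounded_fun f <-> exists2 M : C, 0 < M & forall x, `|f x| <= M.
Proof.
split=> [[M [Mreal fM]]|[M M0 fM]].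
  exists (`|M| + 1); first by rewrite ltr_wpDl.
  by move=> x; apply: fM => //; rewrite ltr_pwDr// real_ler_norm.
exists M; split => [|N MN x _]; first exact: gtr0_real.
by apply: le_trans (fM x) (ltW MN).
Qed.

Lemma is_LUC_cst (c : C) : is_LUC (cst c).
Proof.
split; first split.
- exact: cst_continuous.
- apply/bounded_funE; exists (`|c| + 1); first by rewrite ltr_wpDl.
  by move=> x; rewrite lerDl.
- apply/ltranslate_continuousP => g e e0.
  by apply: nearW => h x; rewrite subrr normr0.
Qed.

Lemma is_LUC_comb (a : C) f g : is_LUC f -> is_LUC g -> is_LUC (a *: f + g).
Proof.
move=> [[cf /bounded_funE[M M0 fM]] /ltranslate_continuousP uf].
move=> [[cg /bounded_funE[N N0 gN]] /ltranslate_continuousP ug].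
split; first split.
- by move=> x; apply: cvgD (cg x); apply: cvgZr (cf x).
- apply/bounded_funE; exists ((`|a| + 1) * M + N).
    by rewrite addr_gt0// mulr_gt0// ltr_wpDl.
  move=> x; rewrite (le_trans (ler_normD _ _))// lerD// normrM ler_pM//.
  by rewrite lerDl.
- apply/ltranslate_continuousP => k e e0.
  have a0 : 0 < `|a| + 1 by rewrite ltr_wpDl.
  have uf' := uf k ((`|a| + 1)^-1 * (e / 2)).
  have ug' := ug k (e / 2).
  apply: filterS2 (uf' _) (ug' _) => [h {}uf' {}ug' x||]; last 2 first.
  - by rewrite !mulr_gt0 ?invr_gt0.
  - exact: divr_gt0.
  rewrite (_ : _ - _ = a * (f (k * x)%g - f (h * x)%g)
     + (g (k * x)%g - g (h * x)%g)); last first.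
    by rewrite mulrBr opprD addrACA.
  rewrite [e]splitr (le_lt_trans (ler_normD _ _))// ltrD//.
  rewrite normrM.
  apply: (@le_lt_trans _ _ ((`|a| + 1) * `|f (k * x)%g - f (h * x)%g|)).
    by rewrite ler_wpM2r// lerDl.
  by rewrite -ltr_pdivlMl.
Qed.

Lemma is_LUC_mul f g : is_LUC f -> is_LUC g -> is_LUC (f * g).
Proof.
move=> [[cf /bounded_funE[M M0 fM]] /ltranslate_continuousP uf].
move=> [[cg /bounded_funE[N N0 gN]] /ltranslate_continuousP ug].
split; first split.
- by move=> x; apply: cvgM (cf x) (cg x).
- apply/bounded_funE; exists (M * N); first exact: mulr_gt0.
  by move=> x; rewrite normrM ler_pM.
- apply/ltranslate_continuousP => k e e0.
  have uf' := uf k (e / 2 / N).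
  have ug' := ug k (M^-1 * (e / 2)).
  apply: filterS2 (uf' _) (ug' _) => [h {}uf' {}ug' x||]; last 2 first.
  - by rewrite !mulr_gt0 ?invr_gt0.
  - by rewrite !mulr_gt0 ?invr_gt0.
  rewrite (_ : _ - _ = f (k * x)%g * (g (k * x)%g - g (h * x)%g)
     + (f (k * x)%g - f (h * x)%g) * g (h * x)%g); last first.
    by rewrite mulrBr mulrBl addrA subrK.
  rewrite [e]splitr (le_lt_trans (ler_normD _ _))// ltrD//.
    rewrite normrM.
    apply: (@le_lt_trans _ _ (M * `|g (k * x)%g - g (h * x)%g|)).
      by rewrite ler_wpM2r.
    by rewrite -ltr_pdivlMl.
  rewrite normrM.
  apply: (@le_lt_trans _ _ (`|f (k * x)%g - f (h * x)%g| * N)).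
    by rewrite ler_wpM2l.
  by rewrite -ltr_pdivlMr.
Qed.

Lemma is_LUC_subring : subring_closed (fun f => f \in is_LUC).
Proof.
split=> [|f g|f g]; rewrite ?inE.
- exact: is_LUC_cst.
- move=> fL gL; rewrite addrC -scaleN1r; exact: is_LUC_comb.
- exact: is_LUC_mul.
Qed.

Lemma is_LUC_submod : submod_closed (fun f => f \in is_LUC).
Proof.
split=> [|a f g]; rewrite ?inE; first exact: is_LUC_cst.
exact: is_LUC_comb.
Qed.

Definition LUC : Type := {f : G -> C | f \in is_LUC}.

HB.instance Definition _ := SubChoice.on LUC.
HB.instance Definition _ :=
  GRing.SubChoice_isSubPzRing.Build _ _ LUC is_LUC_subring.
HB.instance Definition _ :=
  GRing.SubZmodule_isSubLmodule.Build _ _ _ LUC is_LUC_submod.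

Definition LUC_val (f : LUC) : {uniform G -> C} := val f.

HB.instance Definition _ :=
  Topological.copy LUC (initial_topology LUC_val).
HB.instance Definition _ :=
  Uniform.copy LUC (initial_topology LUC_val).

(* A linear functional lies in the dual of [LUC] iff it is continuous.  The
   topology of pointwise convergence is the weak-star topology. *)
Definition Gluc : set {ptws LUC -> C} :=
  [set phi : LUC -> C | [/\ scalar phi, {morph phi : f g / f * g},
     continuous phi & exists f, phi f != 0]].

Definition pteval (x : G) : {ptws LUC -> C} := fun f : LUC => LUC_val f x.

Lemma pteval_Gluc x : Gluc (pteval x).
Proof.
split=> //; last by exists 1; rewrite /pteval /= oner_neq0.
move=> f; apply/cvgrPdist_lt => [|e e0]; first exact: nbhs_filter.
have /cvg_uniformP H := @initial_continuous LUC {uniform G -> C} LUC_val f.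
have := H (fmap_filter _ (nbhs_filter f)) e e0.
by apply: (@filterS _ _ (nbhs_filter f)) => g; exact.
Qed.

Definition Gstar : set {ptws LUC -> C} := Gluc `\` range pteval.

End LUC.

Arguments LUC : clear implicits.
Arguments Gluc : clear implicits.
Arguments Gstar : clear implicits.

Definition P_point (T : topologicalType) (p : T) :=
  forall A : set T, Gdelta A -> A p -> nbhs p A.

(* Main.v *)
(* Let [L] be a bounded length function on [G], continuous at [1], whose unit
   ball is relatively compact, and let [F] be the distance, in the
   right-invariant pseudometric [L (x y^-1)], to a maximal 1-separated subset.
   Then [F] is in LUC(G), every [y] is moved into the zeros of [F] by an element
   of the unit ball, and near a zero [y] of [F] one has [F (g y) = L g] for [g]
   small.  Approximating a character [p] by points and using compactness of the
   unit ball, some left translate [l_v F] is killed by [p], and then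
   [p (l_(g v) F) = L g] for small [g] (a local form of Veech's theorem).
   If [p] were a P-point of [G^*], the zero set of evaluation at [l_v F] would be
   a neighbourhood of [p], hence, as [k |-> k p] is continuous into [G^*], [L]
   would vanish near [1].  But in a nondiscrete group [L] can be chosen to
   separate infinitely many points of a compact set, so it cannot. *)
Require Import Defs.
From mathcomp Require Import all_boot all_order all_algebra.
From mathcomp Require Import complex lra.
From mathcomp Require Import all_classical all_reals topology normedtype.
From mathcomp Require Import subtype_topology borel_hierarchy.

Set Implicit Arguments.
Unset Strict Implicit.
Unset Printing Implicit Defensive.

Import Order.TTheory GRing.Theory Num.Theory.
Import numFieldNormedType.Exports.

Local Open Scope classical_set_scope.
Local Open Scope ring_scope.

(** * Translations and length functions on topological groups *)

Section TopologicalGroup.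
Variable G : topologicalGroupType.
Implicit Types (x y z g h u : G) (A K : set G).

Lemma cvg_mulg (T : Type) (F : set_system T) (FF : Filter F) (a b : T -> G) x y :
  a @ F --> x -> b @ F --> y -> (a t * b t)%g @[t --> F] --> (x * y)%g.
Proof.
move=> ax bY; apply: (@cvg_comp _ _ _ (fun t => (a t, b t))
    (fun xy => xy.1 * xy.2)%g F (nbhs (x, y)) (nbhs (x * y)%g)).
  exact: (@cvg_pair _ _ _ F (nbhs x) (nbhs y)).
exact: (@mulg_continuous G (x, y)).
Qed.

Lemma continuous_mulgr y : continuous (fun x => x * y)%g.
Proof. by move=> x; apply: cvg_mulg; [exact: cvg_id|exact: cvg_cst]. Qed.

Lemma continuous_mulgl y : continuous (fun x => y * x)%g.
Proof. by move=> x; apply: cvg_mulg; [exact: cvg_cst|exact: cvg_id]. Qed.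

Lemma near_mulgr x A : nbhs x A -> \forall u \near (1%g : G), A (u * x)%g.
Proof. by move=> xA; apply: (@continuous_mulgr x 1%g); rewrite mul1g. Qed.

Lemma near_divg x A : nbhs (1%g : G) A -> \forall y \near x, A (y * x^-1)%g.
Proof. by move=> xA; apply: (@continuous_mulgr x^-1%g x); rewrite mulgV. Qed.

Lemma near_invg A : nbhs (1%g : G) A -> \forall u \near (1%g : G), A u^-1%g.
Proof. by move=> A1; apply: (@invg_continuous G 1%g); rewrite invg1. Qed.

Lemma near_conjVg x A : nbhs (1%g : G) A ->
  \forall u \near (1%g : G), A (x^-1 * u * x)%g.
Proof.
move=> A1; apply: (@continuous_comp _ _ _ (fun u => x^-1 * u)%g
  (fun u => u * x)%g 1%g).
- exact: continuous_mulgl.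
- exact: continuous_mulgr.
- by rewrite /= mulg1 mulVg.
Qed.

Variable R : realType.
Implicit Types (f : G -> R) (L : G -> R).

Definition left_uniformly_continuous f :=
  forall e : R, 0 < e ->
    \forall u \near (1%g : G), forall z, `|f (u * z)%g - f z| < e.

(** Joint continuity of [f (u * z) - f z] and compactness give one neighbourhood of [1] that serves
    all of [K]; off [K] the function is constant. *)
Lemma left_uniformly_continuous_cocompact f K : compact K -> continuous f ->
  (forall z, ~ K z -> f z = 1) -> left_uniformly_continuous f.
Proof.
move=> cK cf fK e e0.
have KE : \forall u \near (1%g : G), K `<=` [set z | `|f (u * z)%g - f z| < e].
  apply: (iffLR (compact_near_coveringP K) cK G (nbhs (1%g : G))
    (fun u z => `|f (u * z)%g - f z| < e)) => z Kz.
  have cm : (fun zu : G * G => f (zu.2 * zu.1)%g - f zu.1) @ (z, 1%g) --> (0 : R).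
    rewrite -[X in _ --> X](subrr (f z)); apply: cvgB; last first.
      by apply: (@cvg_comp _ _ _ fst f); [exact: cvg_fst|exact: cf].
    apply: (@cvg_comp _ _ _ (fun zu : G * G => (zu.2 * zu.1)%g) f _ (nbhs z)).
      have := @cvg_mulg _ _ (nbhs_filter (z, 1%g : G)) snd fst 1%g z cvg_snd cvg_fst.
      by rewrite mul1g; exact.
    exact: cf.
  have /cvgrPdist_lt/(_ e e0) := cm.
  by apply: filterS => -[z' u]/=; rewrite sub0r normrN.
have KEV := near_invg KE.
near=> u => z.
have Ku : K `<=` [set z | `|f (u * z)%g - f z| < e] by near: u.
have KVu : K `<=` [set z | `|f (u^-1 * z)%g - f z| < e] by near: u.
have [/Ku//|nKz] := pselect (K z).
(* When only [u * z] lies in [K], the estimate for [u^-1] is applied at that point. *)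
have [/KVu/=|nKuz] := pselect (K (u * z)%g); first by rewrite mulKg distrC.
by rewrite !fK// subrr normr0.
Unshelve. all: by end_near. Qed.

(** The last clause encodes continuity at [1] together with [L 1 = 0]. The associated pseudometric
    [L (x * y^-1)] is right-invariant. *)
Definition length_function L := [/\ forall g h, L (g * h)%g <= L g + L h,
  forall g, L g^-1%g = L g, forall g, 0 <= L g <= 1 &
  forall e, 0 < e -> \forall u \near (1%g : G), L u < e].

Lemma length_of_family (psi : nat -> G -> R) :
  (forall n z, 0 <= psi n z <= 1) ->
  (forall n, left_uniformly_continuous (psi n)) ->
  exists2 L, length_function L &
    forall n g z, n.+1%:R^-1 * `|psi n (g * z)%g - psi n z| <= L g.
Proof.
move=> psi01 upsi.
(* [L g] is the supremum of the oscillations of the [psi n] under left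
   translation by [g]; the weights [n.+1^-1] make it continuous at [1]. *)
pose D g (nz : nat * G) : R :=
  nz.1.+1%:R^-1 * `|psi nz.1 (g * nz.2)%g - psi nz.1 nz.2|.
have w0 n : 0 <= n.+1%:R^-1 :> R by rewrite invr_ge0.
have w1 n : n.+1%:R^-1 <= 1 :> R by rewrite invf_le1// ler1n.
have d1 n g z : `|psi n (g * z)%g - psi n z| <= 1.
  have := psi01 n z; have := psi01 n (g * z)%g; rewrite ler_norml; lra.
have D0 g nz : 0 <= D g nz by rewrite mulr_ge0.
have Dw g nz : D g nz <= nz.1.+1%:R^-1 by rewrite ler_piMr.
have D1 g nz : D g nz <= 1 by rewrite (le_trans (Dw _ _)).
pose L g := sup (range (D g)).
have neD g : range (D g) !=set0 by exists (D g (0%N, 1%g)), (0%N, 1%g).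
have DL g nz : D g nz <= L g.
  by apply: ub_le_sup; [exists 1 => _ [x _ <-]|exists nz].
have LD g c : (forall nz, D g nz <= c) -> L g <= c.
  by move=> Dc; apply: ge_sup => // _ [nz _ <-].
exists L; last by move=> n g z; exact: (DL g (n, z)).
have LV g : L g^-1%g <= L g.
  apply: LD => -[n z]; have := DL g (n, (g^-1 * z)%g).
  by rewrite /D/= mulVKg distrC.
split.
- move=> g h; apply: LD => -[n z].
  have := DL h (n, z); have := DL g (n, (h * z)%g).
  rewrite /D /= => Lg Lh; apply: le_trans (lerD Lg Lh).
  by rewrite -mulrDr ler_wpM2l// mulgA (le_trans _ (ler_normD _ _))// addrA subrK.
- by move=> g; apply/eqP; rewrite eq_le LV/= -{1}(invgK g) LV.
- by move=> g; rewrite (le_trans (D0 g (0%N, 1%g)) (DL _ _))/=; exact: LD.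
- move=> e e0; have e20 : 0 < e / 2 by rewrite divr_gt0.
  have [N Ne] : exists N : nat, N.+1%:R^-1 < e / 2.
    exists (Num.bound (e / 2)^-1); rewrite invf_plt ?posrE//.
    apply: lt_trans (archi_boundP _) _; first by rewrite invr_ge0 ltW.
    by rewrite ltr_nat.
  (* The finitely many indices below [N] are controlled together by uniform continuity; from [N] on
     the weights alone are below [e / 2]. *)
  have HN : \forall u \near (1%g : G), forall n z, (n < N)%N ->
      `|psi n (u * z)%g - psi n z| < e / 2.
    elim: N {Ne} => [|N IH]; first exact: nearW.
    near=> u => n z; rewrite ltnS leq_eqVlt => /orP[/eqP ->|nN].
      by move: z; near: u; exact: upsi.
    by move: n z nN; near: u.
  near=> u; apply: (@le_lt_trans _ _ (e / 2)); last by lra.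
  apply: LD => -[n z]/=; have [Nn|nN] := leqP N n.
    apply: le_trans (Dw _ _) (le_trans _ (ltW Ne)).
    by rewrite lef_pV2 ?posrE// ler_nat.
  apply: (@le_trans _ _ `|psi n (u * z)%g - psi n z|).
    by rewrite /D ler_piMl.
  by apply: ltW; move: n z nN; near: u.
Unshelve. all: by end_near. Qed.

End TopologicalGroup.

(** * Length functions that do not vanish near the identity *)

Section ExistenceOfLength.
Variables (R : realType) (G : topologicalGroupType).
Hypothesis hausdorffG : hausdorff_space G.
Hypothesis locally_compactG : locally_compact [set: G].

Let closed_finite (A : set G) : finite_set A -> closed A.
Proof.
by have /accessible_finite_set_closed := hausdorff_accessible hausdorffG; apply.
Qed.

(** Deleting the finitely many other points of [A] isolates [x], and translation then isolates every
    point. *)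
Lemma finite_nbhs_discrete (x : G) (A : set G) :
  finite_set A -> nbhs x A -> forall B : set G, open B.
Proof.
move=> finA xA; have x1 : nbhs x [set x].
  have cA : closed (A `\ x).
    apply: closed_finite; exact: finite_setD.
  have xAx : nbhs x (~` (A `\ x)).
    by apply: open_nbhs_nbhs; split; [exact/closed_openC|move=> -[_]; exact].
  by apply: filterS2 xA xAx => y Ay nAy; apply: contrapT => yx; exact: nAy.
have one1 : nbhs (1%g : G) [set 1%g].
  apply: filterS (near_mulgr x1) => y yx.
  by apply: (@mulIg G x); rewrite mul1g.
move=> B; rewrite openE => y By; rewrite /interior.
by apply: filterS (near_divg y one1) => z /= zy; rewrite -(mulgVK y z) zy mul1g.
Qed.

Lemma exists_length : ~ (forall A : set G, open A) ->
  exists (L : G -> R) (K : set G), [/\ length_function L, compact K,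
    forall g, L g < 1 -> K g & ~ \forall u \near (1%g : G), L u = 0].
Proof.
move=> nondiscreteG.
have [K K1 [cK _]] := locally_compactG (I : [set: G] 1%g).
have [O [oO O1] OK] : exists O : set G, [/\ open O, O 1%g & O `<=` K].
  have : nbhs (1%g : G) K.
    by apply: (@filterS _ _ _ (fun y => [set: G] y -> K y)) K1 => y; exact.
  by rewrite nbhsE => -[O [oO O1] OK]; exists O.
have /infiniteP/card_leP[f] : infinite_set O.
  move=> finO; apply: nondiscreteG.
  exact: (finite_nbhs_discrete finO (open_nbhs_nbhs (conj oO O1))).
pose x n := set_val (f (SigSub (mem_set (I : [set: nat] n)))).
have Ox n : O (x n) by exact: set_valP.
have xI : injective x.
  by move=> m n /val_inj/inj; rewrite !inE => /(_ I I)/(congr1 val).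
(* [1 - psi n] is supported in [K] and separates [x n] from its predecessors. *)
have sep n : exists psi : G -> R, [/\ continuous psi, forall z, 0 <= psi z <= 1,
    psi (x n) = 0, forall z, ~ K z -> psi z = 1 &
    forall m, (m < n)%N -> psi (x m) = 1].
  pose B := ~` O `|` x @` `I_n.
  have clB : closed B.
    apply: closedU; first exact: open_closedC.
    apply: closed_finite; exact: finite_image.
  have nBx : ~ B (x n).
    by move=> [/(_ (Ox n))//|[m /= mn /xI mnE]]; move: mn; rewrite mnE ltnn.
  have /(@uniform_separatorP G R)[psi [cpsi psi01 psi0 psi1]] :=
    @locally_compact_completely_regular G R locally_compactG hausdorffG
      _ _ clB nBx.
  exists psi; split => //.
  - by move=> z; have := psi01 (psi z); rewrite /= in_itv/=; apply; exists z.
  - by apply: psi0; exists (x n).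
  - by move=> z nKz; apply: psi1; exists z => //; left => /OK.
  - by move=> m mn; apply: psi1; exists (x m) => //; right; exists m.
have [psi psiP] := choice sep.
have [L lenL psiL] : exists2 L, length_function L &
    forall n g z, n.+1%:R^-1 * `|psi n (g * z)%g - psi n z| <= L g.
  apply: length_of_family => n.
    by have [] := psiP n.
  have [cpsi _ _ psiK _] := psiP n.
  exact: left_uniformly_continuous_cocompact cK cpsi psiK.
have [LM LV L01 L1] := lenL.
(* If [L g < 1] then [g * x 0] is in [K]: [psi 0] is [0] at [x 0] and [1] off [K], and its weight is
   [1]. So the unit ball lies in this right translate of [K]. *)
exists L, ((fun y => y * (x 0%N)^-1)%g @` K); split=> //.
- by apply: continuous_compact => //; exact/continuous_subspaceT/continuous_mulgr.
- move=> g Lg; exists (g * x 0%N)%g; last by rewrite mulgK.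
  have [_ _ psi0 psiK _] := psiP 0%N; apply: contrapT => nK.
  have := psiL 0%N g (x 0%N).
  by rewrite psi0 psiK// subr0 normr1 mulr1 invr1 leNgt Lg.
- (* If [L] vanishes near [1], then two of the [x n] close to a cluster point
     [c] are at distance [0] from each other. *)
  move=> L0.
  have [|c [_ clc]] := cK _ (fmap_proper_filter x eventually_filter).
    by exists 0%N => // n _; exact/OK/Ox.
  have cV := near_divg c L0.
  have [_ [[m _ <-] Lm]] : x @` setT `&` [set y | L (y * c^-1)%g = 0] !=set0.
    by apply: clc => //; exists 0%N => // n _; exists n.
  (* The second index is taken beyond [m], so that [psi n] equals [1] at [x m]. *)
  have [_ [[n mn <-] Ln]] :
      x @` [set n | (m < n)%N] `&` [set y | L (y * c^-1)%g = 0] !=set0.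
    by apply: clc => //; exists m.+1 => // n /= mn; exists n.
  have Lmn : L (x m * (x n)^-1)%g <= 0.
    rewrite (_ : _ * _ = (x m * c^-1) * (x n * c^-1)^-1)%g; last by rewrite mulgKA.
    by rewrite (le_trans (LM _ _))// LV Lm Ln addr0.
  have [_ _ psi0 _ psi1] := psiP n.
  have := le_trans (psiL n (x m * (x n)^-1)%g (x n)) Lmn.
  rewrite mulgVK psi0 psi1// subr0 normr1 mulr1 leNgt invr_gt0.
  by rewrite ltr0n.
Qed.

End ExistenceOfLength.

(** * Maximal separated sets and the distance to them *)

Section SeparatedSets.
Variables (R : realType) (G : topologicalGroupType) (L : G -> R).
Hypothesis lenL : length_function L.

Definition separated (X : set G) :=
  forall x y, X x -> X y -> x <> y -> 1 <= L (x * y^-1)%g.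

Let LM g h : L (g * h)%g <= L g + L h. Proof. by have [+ _ _ _] := lenL; exact. Qed.
Let LV g : L (g^-1)%g = L g. Proof. by have [_ + _ _] := lenL; exact. Qed.
Let L01 g : 0 <= L g <= 1. Proof. by have [_ _ + _] := lenL; exact. Qed.

Lemma length1 : L 1%g = 0.
Proof.
have [_ _ _ L1] := lenL; apply/eqP; rewrite eq_le.
have /andP[-> _] := L01 1%g; rewrite andbT leNgt; apply/negP => /L1.
by move=> /nbhs_singleton; rewrite ltxx.
Qed.

(** Zorn's lemma gives a maximal [X]; a point at distance at least [1] from all of [X] could be
    adjoined to it. *)
Lemma exists_maximal_separated : exists2 X : set G, separated X &
  forall y, exists2 x, X x & L (y * x^-1)%g < 1.
Proof.
have [F Fsep totF|X [sepX maxX]] := @Zorn_bigcup G separated.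
  move=> x y [A FA Ax] [B FB By]; have [AB|BA] := totF _ _ FA FB.
    exact: (Fsep B FB x y (AB _ Ax) By).
  exact: (Fsep A FA x y Ax (BA _ By)).
exists X => // y; apply: contrapT => /forall2NP far.
have far1 x : X x -> 1 <= L (y * x^-1)%g.
  by move=> Xx; have [//|/negP] := far x; rewrite -leNgt.
have nXy : ~ X y by move=> /far1; rewrite mulgV length1 ler10.
apply: (maxX (X `|` [set y])).
  by split; [exact: subsetUl|move=> XyX; apply: nXy; apply: XyX; right].
move=> a b [Xa|->] [Xb|->] ab //; [exact: sepX| |exact: far1].
by rewrite -LV invgM invgK far1.
Qed.

Lemma exists_distance : exists F : G -> R, [/\
  forall y, 0 <= F y <= 1,
  forall g y, F (g * y)%g <= L g + F y,
  forall g y, L g <= 2^-1 -> L g <= F (g * y)%g + F y &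
  forall y, exists2 x, L (x * y^-1)%g < 1 & F x = 0].
Proof.
have [X sepX maxX] := exists_maximal_separated.
pose D y := (fun x => L (y * x^-1)%g) @` X; pose F y := inf (D y).
have FD y x : X x -> F y <= L (y * x^-1)%g.
  move=> Xx; apply: ge_inf; last by exists x.
  by exists 0 => _ [z _ <-]; have /andP[] := L01 (y * z^-1)%g.
have DF y c : (forall x, X x -> c <= L (y * x^-1)%g) -> c <= F y.
  move=> cD; apply: lb_le_inf => [|_ [x Xx <-]]; last exact: cD.
  by have [x Xx _] := maxX y; exists (L (y * x^-1)%g), x.
have F0 y : 0 <= F y by apply: DF => x _; have /andP[] := L01 (y * x^-1)%g.
exists F; split.
- move=> y; rewrite F0/=; have [x Xx _] := maxX y.
  by rewrite (le_trans (FD y x Xx))//; have /andP[] := L01 (y * x^-1)%g.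
- move=> g y; rewrite -lerBlDl; apply: DF => x Xx; rewrite lerBlDl.
  by apply: le_trans (FD _ x Xx) _; rewrite -mulgA LM.
- move=> g y Lg; rewrite -lerBlDl; apply: (DF) => x Xx.
  rewrite lerBlDl -lerBlDr; apply: DF => x' Xx'; rewrite lerBlDr.
  (* If the same point of [X] serves [y] and [g * y], this is the triangle inequality. Otherwise [x]
     and [x'] are at distance at least [1], so the two distances add up to at least [1 - L g], which
     is at least [L g]. *)
  have [->|/eqP xx'] := eqVneq x x'.
    rewrite -(LV (y * x'^-1)%g); apply: le_trans (LM _ _).
    by rewrite -(mulgA g) mulgK.
  have := sepX x x' Xx Xx' xx'.
  have -> : (x * x'^-1 = (y * x^-1)^-1 * (g^-1 * (g * y * x'^-1)))%g.
    by rewrite invgM invgK !mulgA mulgVK mulgVK.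
  have := LM (y * x^-1)^-1%g (g^-1 * (g * y * x'^-1))%g.
  have := LM g^-1%g (g * y * x'^-1)%g; rewrite !LV; lra.
- move=> y; have [x Xx Lyx] := maxX y; exists x; first by rewrite -LV invgM invgK.
  by apply/eqP; rewrite eq_le F0 (le_trans (FD x x Xx))// mulgV length1.
Qed.

End SeparatedSets.

(** * Closure properties of LUC(G) *)

Section LUCClosure.
Variables (R : realType) (G : topologicalGroupType).
Local Notation C := (Cplx R).
Implicit Types f : G -> C.

(** Continuity of [f] at [x] is the uniform estimate at [x] evaluated at the identity. *)
Lemma is_LUCP f : is_LUC f <->
  (exists2 M : C, 0 < M & forall x, `|f x| <= M) /\
  forall g (e : C), 0 < e ->
    \forall h \near g, forall x, `|f (g * x)%g - f (h * x)%g| < e.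
Proof.
split=> [[[_ /bounded_funE bf] /ltranslate_continuousP uf]|[bf uf]]; first by [].
split; last exact/ltranslate_continuousP.
split; last exact/bounded_funE.
move=> x; apply/cvgrPdist_lt => e e0; apply: filterS (uf x e e0) => y /(_ 1%g).
by rewrite !mulg1.
Qed.

Lemma is_LUC_conj f : is_LUC f -> is_LUC (fun x => (f x)^*).
Proof.
move=> /is_LUCP[[M M0 fM] uf]; apply/is_LUCP; split.
  by exists M => // x; rewrite norm_conjC.
move=> g e e0; apply: filterS (uf g e e0) => h fh x.
by rewrite -rmorphB norm_conjC.
Qed.

Lemma is_LUC_inv f (c : C) : 0 < c -> (forall x, c <= `|f x|) ->
  is_LUC f -> is_LUC (fun x => (f x)^-1).
Proof.
move=> c0 cf /is_LUCP[_ uf]; apply/is_LUCP.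
have f0 x : f x != 0 by rewrite -normr_gt0 (lt_le_trans c0).
have fV x : `|(f x)^-1| <= c^-1 by rewrite normfV lef_pV2 ?posrE ?normr_gt0.
split; first by exists c^-1; rewrite ?invr_gt0.
move=> g e e0.
(* Each inverse is bounded by [c^-1], and the difference of inverses contains two of them. *)
have cec : 0 < c * e * c by rewrite !mulr_gt0.
apply: filterS (uf g _ cec) => h fh x.
rewrite (_ : _ - _ = (f (g * x)%g)^-1 * (f (h * x)%g - f (g * x)%g)
    * (f (h * x)%g)^-1); last first.
  by rewrite mulrBr mulrBl mulVf// mul1r mulfK.
rewrite !normrM distrC.
apply: (@le_lt_trans _ _ (c^-1 * `|f (g * x)%g - f (h * x)%g| * c^-1)).
  by rewrite ler_pM// ?mulr_ge0// ler_wpM2r.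
by rewrite ltr_pdivrMr// ltr_pdivrMl// mulrA.
Qed.

Lemma is_LUC_ltranslate (k : G) f : is_LUC f -> is_LUC (ltranslate k f).
Proof.
move=> /is_LUCP[[M M0 fM] uf]; apply/is_LUCP; split.
  by exists M => // x; exact: fM.
move=> g e e0.
have kf : \forall h \near g, forall x,
    `|f (k * g * x)%g - f (k * h * x)%g| < e.
  exact: (@continuous_mulgl G k g _ (uf (k * g)%g e e0)).
by apply: filterS kf => h fh x; rewrite /ltranslate !mulgA.
Qed.

Lemma small_eq0 (z : C) : (forall e : R, 0 < e -> `|z| < (e%:C)%C) -> z = 0.
Proof.
move=> ze; apply/eqP; apply: contrapT => /negP; rewrite -normr_gt0 => z0.
have zE : `|z| = ((complex.Re `|z|)%:C)%C.
  by apply/esym/RRe_real; exact: normr_real.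
have r0 : 0 < complex.Re `|z| by rewrite -ltcR -zE.
by have := ze _ r0; rewrite -zE ltxx.
Qed.

Definition mkLUC f (fL : is_LUC f) : LUC R G := exist _ f (mem_set fL).

Lemma LUC_valP (f : LUC R G) : is_LUC (LUC_val f).
Proof. exact: set_mem (valP f). Qed.

Lemma LUC_valD (f h : LUC R G) x : LUC_val (f + h) x = LUC_val f x + LUC_val h x.
Proof. by []. Qed.

Lemma LUC_valM (f h : LUC R G) x : LUC_val (f * h) x = LUC_val f x * LUC_val h x.
Proof. by []. Qed.

Lemma LUC_valZ a (f : LUC R G) x : LUC_val (a *: f) x = a * LUC_val f x.
Proof. by []. Qed.

Lemma LUC_val1 x : LUC_val (1 : LUC R G) x = 1.
Proof. by []. Qed.

Lemma LUC_eq (f h : LUC R G) : LUC_val f =1 LUC_val h -> f = h.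
Proof. by move=> fh; apply: val_inj; exact: funext. Qed.

End LUCClosure.

(** * Characters as limits of point evaluations *)

Section Characters.
Variables (R : realType) (G : topologicalGroupType).
Local Notation C := (Cplx R).
Variable p : LUC R G -> C.
Hypothesis Gp : Gluc R G p.

Let pD f h : p (f + h) = p f + p h.
Proof. by have [pl _ _ _] := Gp; have := pl 1 f h; rewrite scale1r mul1r. Qed.

Let p0 : p 0 = 0.
Proof. by apply: (addIr (p 0)); rewrite -pD !add0r. Qed.

Let pZ a f : p (a *: f) = a * p f.
Proof. by have [pl _ _ _] := Gp; have := pl a f 0; rewrite p0 !addr0. Qed.

Let pM f h : p (f * h) = p f * p h.
Proof. by have [_ + _ _] := Gp; exact. Qed.

Let p1 : p 1 = 1.
Proof.
have [_ _ _ [f pf]] := Gp; apply: (mulfI pf).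
by rewrite -pM !mulr1.
Qed.

(** Otherwise [f] is bounded away from [0], hence invertible in LUC(G), and [p] cannot kill a
    unit. *)
Lemma character_kernel_small (f : LUC R G) (e : C) : 0 < e -> p f = 0 ->
  exists x, `|LUC_val f x| < e.
Proof.
move=> e0 pf; apply: contrapT => /forallNP nf.
have ef x : e <= `|LUC_val f x|.
  by have /negP := nf x; rewrite real_ltNge ?negbK ?normr_real ?gtr0_real.
have : f * mkLUC (is_LUC_inv e0 ef (LUC_valP f)) = 1.
  apply: LUC_eq => x; rewrite LUC_valM /= mulfV//.
  by rewrite -normr_gt0 (lt_le_trans e0).
move=> /(congr1 p); rewrite pM pf mul0r p1 => /esym/eqP.
by rewrite oner_eq0.
Qed.

(** This is the density of [G] in its spectrum: point evaluations converge to [p] along [F]. *)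
Lemma character_filter : exists2 F : set_system G, ProperFilter F &
  forall f (e : C), 0 < e -> \forall x \near F, `|LUC_val f x - p f| < e.
Proof.
(* Stable under intersection: two elements [k], [l] of the kernel are dominated
   by the kernel element [|k|^2 + |l|^2]. *)
pose F := [set A : set G | exists2 k, p k = 0 &
  forall x, `|LUC_val k x| < 1 -> A x].
exists F.
  apply: Build_ProperFilter_ex.
    move=> A [k pk kA]; have [x /kA Ax] := character_kernel_small ltr01 pk.
    by exists x.
  split.
  - by exists 0.
  - move=> A B [k pk kA] [l pl lB].
    exists (k * mkLUC (is_LUC_conj (LUC_valP k))
      + l * mkLUC (is_LUC_conj (LUC_valP l))).
      by rewrite pD !pM pk pl !mul0r addr0.
    move=> x; rewrite LUC_valD !LUC_valM /= -!normCK ger0_norm; last first.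
      by rewrite addr_ge0// exprn_ge0.
    move=> kl.
    have lt1 (a b : C) : 0 <= a -> 0 <= b -> a ^+ 2 + b ^+ 2 < 1 -> a < 1.
      move=> a0 b0 ab; rewrite -(@expr_lt1 _ 2)//; apply: le_lt_trans ab.
      by rewrite lerDl exprn_ge0.
    split; first by apply/kA/(lt1 _ _ _ _ kl).
    by apply/lB/(lt1 _ `|LUC_val k x|) => //; rewrite addrC.
  - by move=> A B AB [k pk kA]; exists k => // x /kA/AB.
(* The kernel element is [f - p f], rescaled so that the threshold [1] becomes [e]. *)
move=> f e e0; exists (e^-1 *: (f + (- p f) *: (1 : LUC R G))).
  by rewrite pZ pD pZ p1 mulr1 subrr mulr0.
move=> x; rewrite LUC_valZ LUC_valD LUC_valZ LUC_val1 mulr1.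
by rewrite normrM normfV (gtr0_norm e0) ltr_pdivrMl// mulr1; exact.
Qed.

End Characters.

(** * The action of [G] on LUC(G) and on its spectrum *)

Section Translates.
Variables (R : realType) (G : topologicalGroupType).
Local Notation C := (Cplx R).

Lemma near_LUC (f : LUC R G) (e : C) : 0 < e ->
  \forall h \near f, forall x, `|LUC_val f x - LUC_val h x| < e.
Proof.
move=> e0; have /cvg_uniformP H :=
  @initial_continuous (LUC R G) {uniform G -> C} (@LUC_val R G) f.
exact: (H (fmap_filter _ (nbhs_filter f)) e e0).
Qed.

Definition LUC_translate (k : G) (f : LUC R G) : LUC R G :=
  mkLUC (is_LUC_ltranslate k (LUC_valP f)).

Lemma LUC_translateE k f x : LUC_val (LUC_translate k f) x = LUC_val f (k * x)%g.
Proof. by []. Qed.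

Lemma LUC_translateM g k f :
  LUC_translate k (LUC_translate g f) = LUC_translate (g * k)%g f.
Proof. by apply: LUC_eq => x; rewrite !LUC_translateE mulgA. Qed.

Lemma LUC_translate1 f : LUC_translate 1%g f = f.
Proof. by apply: LUC_eq => x; rewrite LUC_translateE mul1g. Qed.

Lemma LUC_translate_continuous k : continuous (LUC_translate k).
Proof.
apply: continuous_comp_initial => f.
apply/cvg_uniformP => [|e e0].
  exact: (fmap_filter _ (nbhs_filter f)).
by apply: (@filterS _ _ (nbhs_filter f)) (near_LUC f e0) => h fh x; exact: fh.
Qed.

Lemma LUC_orbit_continuous f : continuous (LUC_translate ^~ f).
Proof. by apply: continuous_comp_initial; have [_ +] := LUC_valP f; exact. Qed.

(** On point evaluations this is left multiplication: evaluation at [x] goes to evaluation at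
    [k * x]. *)
Definition char_translate (k : G) (p : {ptws LUC R G -> C}) :
  {ptws LUC R G -> C} := fun f => p (LUC_translate k f).

Lemma Gluc_translate k p : Gluc R G p -> Gluc R G (char_translate k p).
Proof.
move=> [pl pM pc [f pf]]; split.
- move=> a f1 f2; rewrite /char_translate -pl; congr (p _); exact: LUC_eq.
- move=> f1 f2; rewrite /char_translate -pM; congr (p _); exact: LUC_eq.
- by move=> h; apply: (@continuous_comp _ _ _ (LUC_translate k) p);
    [exact: LUC_translate_continuous|exact: pc].
- exists (LUC_translate k^-1%g f).
  by rewrite /char_translate LUC_translateM mulVg LUC_translate1.
Qed.

(** If the translate were evaluation at [x], then [p] would be evaluation at [k^-1 * x]. *)
Lemma Gstar_translate k p : Gstar R G p -> Gstar R G (char_translate k p).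
Proof.
move=> [Gp np]; split; first exact: Gluc_translate.
move=> [x _ xp]; apply: np; exists (k^-1 * x)%g => //.
apply/funext => f; have := congr1 (fun q => q (LUC_translate k^-1%g f)) xp.
by rewrite /char_translate LUC_translateM mulVg LUC_translate1.
Qed.

(** For each [f], the norm-continuous orbit map [k |-> l_k f] is followed by the continuous
    functional [p]. *)
Lemma char_translate_continuous p : Gluc R G p ->
  continuous (fun k => char_translate k p).
Proof.
move=> [_ _ pc _] k; apply/pointwise_cvgP => f.
apply: (@continuous_comp _ _ _ (LUC_translate ^~ f) p).
  exact: LUC_orbit_continuous.
exact: pc.
Qed.

Lemma Gdelta_zeros (T : topologicalType) (u : T -> C) : continuous u ->
  Gdelta [set t | u t = 0].
Proof.
move=> cu; exists (fun n => u @^-1` ball (0 : C) n.+1%:R^-1).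
  move=> n; apply: open_comp; first by move=> x _; exact: cu.
  by apply: ball_open; rewrite invr_gt0.
apply/seteqP; split=> [t /= ut n _|t /= ut].
  by rewrite /= ut; apply: ballxx; rewrite invr_gt0.
apply: small_eq0 => e e0.
have ne : ((Num.bound e^-1).+1%:R^-1 : R) < e.
  rewrite invf_plt ?posrE//; apply: lt_trans (archi_boundP _) _.
    by rewrite invr_ge0 ltW.
  by rewrite ltr_nat.
have := ut (Num.bound e^-1) I; rewrite /ball/= sub0r normrN => /lt_trans; apply.
by rewrite -ltcR fmorphV rmorph_nat in ne.
Qed.

End Translates.

(** * Characters evaluated at translates of the distance function *)

Section DistanceCharacters.
Variables (R : realType) (G : topologicalGroupType) (L : G -> R) (F : G -> R).
Local Notation C := (Cplx R).
Hypothesis lenL : length_function L.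
Hypothesis F01 : forall y, 0 <= F y <= 1.
Hypothesis FL : forall g y, F (g * y)%g <= L g + F y.

Lemma norm_realC (r : R) : `|(r%:C)%C| = (`|r|%:C)%C.
Proof. by rewrite normc_def /= expr0n addr0 sqrtr_sqr. Qed.

Lemma posC (e : C) : 0 < e -> exists2 r : R, 0 < r & e = (r%:C)%C.
Proof.
move=> e0; have eE : ((complex.Re e)%:C)%C = e by apply/RRe_real/gtr0_real.
by exists (complex.Re e); rewrite // -ltcR eE.
Qed.

(** By [FL], [F (g * x)] and [F (h * x)] differ by at most [L (h * g^-1)], uniformly in [x]. *)
Lemma is_LUC_distance : is_LUC (fun x => (F x)%:C%C : C).
Proof.
apply/is_LUCP; split.
  exists 1 => // x; rewrite norm_realC -[1]/((1 : R)%:C)%C lecR.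
  by have /andP[F0 F1] := F01 x; rewrite ger0_norm.
have [_ LV _ L1] := lenL.
move=> g _ /posC[e e0 ->]; apply: filterS (near_divg g (L1 e e0)) => h Lhg x.
rewrite -rmorphB norm_realC ltcR; apply: le_lt_trans Lhg.
have := FL (h * g^-1)%g (g * x)%g; have := FL (g * h^-1)%g (h * x)%g.
rewrite !mulgA !mulgVK -(LV (g * h^-1)%g) invgM invgK ler_norml; lra.
Qed.

Let f : LUC R G := mkLUC is_LUC_distance.
Variable p : LUC R G -> C.
Hypothesis Gp : Gluc R G p.

(** Choose [w y] in [K] moving [y] to a zero of [F], and let [v] be a cluster point of [w] along the
    filter converging to [p]. Then [F (v * y)] is at most [L (v * (w y)^-1)], which is small for
    suitable [y] near [p]. *)
Lemma distance_translate_vanishes (K : set G) : compact K ->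
  (forall y, exists2 u, K u & F (u * y)%g = 0) ->
  exists v, p (LUC_translate v f) = 0.
Proof.
move=> cK KF; have [H HP Hp] := character_filter Gp.
have [w wP] : {w : G -> G & forall y, K (w y) /\ F (w y * y)%g = 0}.
  by apply: (@choice _ _ (fun y u => K u /\ F (u * y)%g = 0)) => y;
    have [u Ku Fu] := KF y; exists u.
have [|v [_ clv]] := cK _ (fmap_proper_filter w HP).
  by apply: (@filterS _ H _ setT) filterT => y _; have [] := wP y.
exists v; apply: small_eq0 => e e0.
have e20 : 0 < e / 2 by rewrite divr_gt0.
have e2C : 0 < ((e / 2)%:C)%C :> C by rewrite ltcR.
have [_ LV _ L1] := lenL.
have Hv := Hp (LUC_translate v f) _ e2C.
have Lv := near_divg v (L1 _ e20).
have wHv : (w @ H) (w @` [set y | `|LUC_val (LUC_translate v f) y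
    - p (LUC_translate v f)| < ((e / 2)%:C)%C]).
  by apply: (@filterS _ H) Hv => y Hy; exists y.
have [_ [[y /= Hy <-] Lw]] := clv _ _ wHv Lv.
have [_ wy0] := wP y.
have Fv : F (v * y)%g < e / 2.
  have := FL (v * (w y)^-1)%g (w y * y)%g.
  rewrite mulgA mulgVK wy0 addr0 -LV invgM invgK => /le_lt_trans; apply.
  exact: Lw.
rewrite -(subKr (LUC_val (LUC_translate v f) y) (p _)).
apply: le_lt_trans (ler_normB _ _) _.
rewrite (splitr e) rmorphD ltrD// LUC_translateE /= norm_realC ltcR ger0_norm//.
by have /andP[] := F01 (v * y)%g.
Qed.

(** If [L g] were positive, some [y] near [p] would make both [F (v * y)] and [F (g * v * y)] less
    than [L g / 2], against the lower bound on their sum. *)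
Lemma distance_translate_vanishes_length v g :
  (forall h y, L h <= 2^-1 -> L h <= F (h * y)%g + F y) ->
  p (LUC_translate v f) = 0 -> p (LUC_translate (g * v)%g f) = 0 ->
  L g <= 2^-1 -> L g = 0.
Proof.
move=> LF pv pgv Lg; have [H HP Hp] := character_filter Gp.
have [_ _ /(_ g)/andP[Lg0 _] _] := lenL.
apply/eqP; rewrite eq_le Lg0 andbT leNgt; apply/negP => {}Lg0.
have e20 : 0 < ((L g / 2)%:C)%C :> C by rewrite ltcR divr_gt0.
have [y [/=]] := filter_ex (filterI (Hp (LUC_translate v f) _ e20)
  (Hp (LUC_translate (g * v)%g f) _ e20)).
rewrite pv pgv !subr0 !LUC_translateE /= !norm_realC !ltcR -mulgA.
have := LF g (v * y)%g Lg; have := ler_norm (F (v * y)%g).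
have := ler_norm (F (g * (v * y))%g); lra.
Qed.

End DistanceCharacters.

Theorem corollary2p6 (R : realType) (G : topologicalGroupType)
    (hausdorffG : hausdorff_space G)
    (locally_compactG : locally_compact [set: G])
    (nondiscreteG : ~ (forall A : set G, open A)) :
  ~ (exists p : set_type (Gstar R G), P_point p).
Proof.
move=> [p Pp].
have [L [K [lenL cK LK nL]]] :=
  exists_length R hausdorffG locally_compactG nondiscreteG.
have [F [F01 FL LF F0]] := exists_distance lenL.
have Gp : Gstar R G (set_val p) by exact: set_valP.
pose f := mkLUC (is_LUC_distance lenL F01 FL).
have [v pv] : exists v, set_val p (LUC_translate v f) = 0.
  apply: (distance_translate_vanishes lenL F01 FL Gp.1 cK) => y.
  have [x Lxy Fx] := F0 y; exists (x * y^-1)%g; first exact: LK.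
  by rewrite mulgVK.
(* The orbit map is corestricted to the subspace [G^*], where the P-point property is stated. *)
pose orb k : set_type (Gstar R G) := SigSub (mem_set (Gstar_translate k Gp)).
have orb1 : orb 1%g = p.
  by apply: val_inj; apply/funext => h; rewrite /= /char_translate LUC_translate1.
have corb : continuous orb.
  by apply: continuous_comp_initial; exact: (char_translate_continuous Gp.1).
have cev : continuous
    (fun q : set_type (Gstar R G) => set_val q (LUC_translate v f)).
  move=> q; have /pointwise_cvgP ev :=
    @initial_continuous (set_type (Gstar R G)) _ set_val q.
  exact: (ev (fmap_filter _ (nbhs_filter q))).
have near0 : \forall k \near (1%g : G),
    set_val p (LUC_translate (v * k)%g f) = 0.
  have := Pp _ (Gdelta_zeros cev) pv; rewrite -{1}orb1 => /corb.
  apply: (@filterS _ (nbhs (1%g : G))) => k pk.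
  by rewrite -LUC_translateM; exact: pk.
apply: nL; have [_ _ _ L1] := lenL.
have L12 : \forall u \near (1%g : G), L u < 2^-1 by apply: L1; rewrite invr_gt0.
(* Putting [k = v^-1 * u * v] turns [v * k] into [u * v], the form required of the second
   translate. *)
apply: filterS2 L12 (near_conjVg v near0) => u Lu.
rewrite !mulgA mulgV mul1g => pu.
exact: (distance_translate_vanishes_length Gp.1 LF pv pu (ltW Lu)).
Qed.
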